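(* Let $R$ be a Noetherian ring and $M$ a finitely generated $R$-module, and suppose $M$ admits a prime filtration $\mathcal{F}: (0)=M_0\subset M_1\subset\cdots\subset M_{r-1}\subset M_r=M$ with $M_i/M_{i-1}\cong R/P_i$, $P_i$ a prime ideal, for all $i=1,\dots,r$. Then for $j=1,\ldots,r$ there exist irreducible $P_j$-primary submodules $N_j$ of $M$ such that $M_i=\bigcap_{j=i+1}^rN_j$ for $i=0,\ldots,r$.
   Context: A proper submodule $N\subset M$ is irreducible if $N=W_1\cap W_2$ with submodules $W_1,W_2$ of $M$ implies $N=W_1$ or $N=W_2$; it is $P$-primary if $\operatorname{Ass}(M/N)=\{P\}$. The empty intersection (for $i=r$) is $M$. *)

(* Defs.v *)
From HB Require Import structures.
From mathcomp Require Import all_boot all_algebra.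
From mathcomp Require Import boolp.

Set Implicit Arguments.
Unset Strict Implicit.
Unset Printing Implicit Defensive.

Import GRing.Theory.
Local Open Scope ring_scope.
Local Open Scope quotient_scope.

(* A submodule of M is an element of [submodClosed M], and an ideal of R an
   element of [submodClosed R^o]. These are boolean predicates; classically this
   is no restriction. *)
Lemma submodClosed_ofProp (R : pzRingType) (M : lmodType R) (S : M -> Prop) :
    S 0 -> (forall a x y, S x -> S y -> S (a *: x + y)) ->
  exists N : submodClosed M, forall x, x \in N <-> S x.
Proof.
move=> S0 SL.
pose p : {pred M} := fun x => `[< S x >].
have pP : submod_closed p.
  split; first exact/asboolP.
  by move=> a x y /asboolP Sx /asboolP Sy; apply/asboolP/SL.
pose mix := GRing.isSubmodClosed.Build R M p pP.
pose N : submodClosed M := HB.pack p mix.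
by exists N => x; split=> /asboolP.
Qed.

(* [submodClosed] does not by itself provide closure under opposites, which the
   quotient of the library requires. *)
Section SubmodOpp.
Variables (R : pzRingType) (M : lmodType R) (N : submodClosed M).

Definition submod_pred : {pred M} := N.

Lemma submod_pred_closed : submod_closed submod_pred.
Proof. exact: submodClosedP. Qed.

HB.instance Definition _ :=
  GRing.isSubmodClosed.Build R M submod_pred submod_pred_closed.
End SubmodOpp.

Section QuotientModule.
Variables (R : pzRingType) (M : lmodType R) (N : submodClosed M).

Definition quotmod : Type := Quotient.quot (submod_pred N).
HB.instance Definition _ := GRing.Zmodule.on quotmod.

Definition quotmod_pi (x : M) : quotmod := \pi_(Quotient.quot (submod_pred N)) x.
Definition quotmod_scale (a : R) (q : quotmod) : quotmod :=
  quotmod_pi (a *: repr (q : Quotient.quot (submod_pred N))).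

Lemma quotmod_pi_eq x y : quotmod_pi x = quotmod_pi y <-> x - y \in N.
Proof.
have := Quotient.idealrBE (submod_pred N) x y.
by move=> E; split=> [/eqP|H]; [rewrite -E|apply/eqP; rewrite -E].
Qed.

Lemma quotmod_piD : {morph quotmod_pi : x y / x + y}.
Proof. exact: raddfD. Qed.

Lemma quotmod_pi_surj q : exists x, q = quotmod_pi x.
Proof. by exists (repr (q : Quotient.quot (submod_pred N))); rewrite /quotmod_pi reprK. Qed.

Lemma quotmod_scaleE a x : quotmod_scale a (quotmod_pi x) = quotmod_pi (a *: x).
Proof.
apply/quotmod_pi_eq; rewrite -scalerBr rpredZ //.
by apply/quotmod_pi_eq; rewrite /quotmod_pi reprK.
Qed.

Lemma quotmod_scaleA a b q :
  quotmod_scale a (quotmod_scale b q) = quotmod_scale (a * b) q.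
Proof. by have [x ->] := quotmod_pi_surj q; rewrite !quotmod_scaleE scalerA. Qed.

Lemma quotmod_scale1 : left_id 1 quotmod_scale.
Proof. by move=> q; have [x ->] := quotmod_pi_surj q; rewrite quotmod_scaleE scale1r. Qed.

Lemma quotmod_scaleDr : right_distributive quotmod_scale +%R.
Proof.
move=> a p q; have [x ->] := quotmod_pi_surj p; have [y ->] := quotmod_pi_surj q.
by rewrite -quotmod_piD !quotmod_scaleE -quotmod_piD scalerDr.
Qed.

Lemma quotmod_scaleDl q : {morph quotmod_scale^~ q : a b / a + b}.
Proof.
move=> a b; have [x ->] := quotmod_pi_surj q.
by rewrite !quotmod_scaleE -quotmod_piD scalerDl.
Qed.

HB.instance Definition _ := GRing.Zmodule_isLmodule.Build R quotmod
  quotmod_scaleA quotmod_scale1 quotmod_scaleDr quotmod_scaleDl.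

Lemma quotmod_pi_is_linear : linear quotmod_pi.
Proof. by move=> a x y; rewrite quotmod_piD -quotmod_scaleE. Qed.

HB.instance Definition _ :=
  GRing.isLinear.Build R M quotmod _ quotmod_pi quotmod_pi_is_linear.
End QuotientModule.

Section Submodule.
Variables (R : pzRingType) (M : lmodType R) (N : submodClosed M).

Definition submod : Type := {x : M | x \in N}.
HB.instance Definition _ := SubChoice.on submod.
HB.instance Definition _ := [SubChoice_isSubLmodule of submod by <:].

(* The submodule K \cap N of N. *)
Variable K : submodClosed M.
Definition within : {pred submod} := fun x => val x \in K.

Lemma within_closed : submod_closed within.
Proof.
split=> [|a x y Kx Ky]; first by rewrite unfold_in raddf0 rpred0.
by rewrite unfold_in linearP rpredD // rpredZ.
Qed.

HB.instance Definition _ := GRing.isSubmodClosed.Build R submod within within_closed.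
End Submodule.
Arguments within {R M} N K _.

Definition isomorphic (R : pzRingType) (A B : lmodType R) : Prop :=
  exists f : {linear A -> B}, bijective f.

Definition finitely_generated (R : pzRingType) (M : lmodType R) : Prop :=
  exists (n : nat) (g : 'I_n -> M),
    forall x : M, exists c : 'I_n -> R, x = \sum_(i < n) c i *: g i.

Definition noetherian (R : comPzRingType) : Prop :=
  forall I : submodClosed R^o, finitely_generated (submod I).

(* The library's [prime_idealr] is restricted to nonzero rings. *)
Definition prime_ideal (R : comPzRingType) (P : submodClosed R^o) : Prop :=
  1 \notin P /\ forall u v : R, u * v \in P -> (u \in P) || (v \in P).

Definition associated_prime (R : comPzRingType) (M : lmodType R)
    (P : submodClosed R^o) : Prop :=
  prime_ideal P /\ exists x : M, forall a : R, a \in P <-> a *: x = 0.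

Definition proper (R : pzRingType) (M : lmodType R) (N : submodClosed M) : Prop :=
  exists x : M, x \notin N.

Definition irreducible (R : pzRingType) (M : lmodType R) (N : submodClosed M) :
    Prop :=
  proper N /\
  forall W1 W2 : submodClosed M, N =i [predI W1 & W2] -> N =i W1 \/ N =i W2.

Definition primary (R : comPzRingType) (M : lmodType R) (P : submodClosed R^o)
    (N : submodClosed M) : Prop :=
  proper N /\
  forall Q : submodClosed R^o, associated_prime (quotmod N) Q <-> Q =i P.

(* The prime [P i], for i : 'I_r, belongs to the (i+1)-st step
   [F i] \subset [F (i+1)]; the inclusion is strict since R/P is nonzero. *)
Definition prime_filtration (R : comPzRingType) (M : lmodType R) (r : nat)
    (F : 'I_r.+1 -> submodClosed M) (P : 'I_r -> submodClosed R^o) : Prop :=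
  [/\ F ord0 =i pred1 0,
      F ord_max =i predT &
      forall i : 'I_r,
        let F0 := F (widen_ord (leqnSn r) i) in
        let F1 := F (lift ord0 i) in
        [/\ {subset F0 <= F1},
            prime_ideal (P i) &
            isomorphic (quotmod (within F1 F0)) (quotmod (P i))]].

(* Main.v *)
(* For a step K = M_(j-1) of the filtration, with L = M_j, take N_j maximal among
   the submodules N containing K with N \cap L = K. Then L/K embeds in M/N_j as
   an essential submodule. Since R/P_j is a domain, any two nonzero submodules of
   L/K meet and every nonzero element of it has annihilator P_j; essentiality
   transfers this to M/N_j, so that 0 is irreducible in M/N_j and P_j is its only
   associated prime. From M_(j-1) = M_j \cap N_j, the intersection formula follows
   by descending induction. *)
Require Import Defs.
From mathcomp Require Import all_boot all_algebra.
From mathcomp Require boolp classical_sets.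
Import GRing.Theory.
Local Open Scope ring_scope.

Lemma submod_rpredB (R : pzRingType) (M : lmodType R) (N : submodClosed M)
    (x y : M) : x \in N -> y \in N -> x - y \in N.
Proof. by move=> Nx Ny; rewrite -scaleN1r rpredD // rpredZ. Qed.

Lemma submod_subrK (R : pzRingType) (M : lmodType R) (N : submodClosed M)
    (x y : M) : x - y \in N -> (x \in N) = (y \in N).
Proof.
move=> Nxy; apply/idP/idP => [Nx|Ny]; last by rewrite -(subrK y x) rpredD.
by rewrite -(subKr x y) submod_rpredB.
Qed.

(** When [K] is contained in [L], the first two clauses amount to [N] \cap [L] = [K]. *)
Definition maximal_meeting {R : pzRingType} {M : lmodType R}
    (K L N : submodClosed M) : Prop :=
  [/\ {subset K <= N},
      forall x, x \in N -> x \in L -> x \in K &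
      forall W : submodClosed M, {subset N <= W} ->
        (forall x, x \in W -> x \in L -> x \in K) -> {subset W <= N}].

Lemma exists_maximal_meeting (R : pzRingType) (M : lmodType R)
    (K L : submodClosed M) : exists N, maximal_meeting K L N.
Proof.
(* Zorn's lemma is applied to sets A such that A \cup K is a suitable submodule,
   so that the empty chain needs no special treatment. *)
pose S (A : classical_sets.set M) x := A x \/ x \in K.
pose good (A : classical_sets.set M) :=
  (forall a x y, S A x -> S A y -> S A (a *: x + y)) /\
  (forall x, S A x -> x \in L -> x \in K).
have [A [[linA AL] maxA]] : exists A, good A /\
    forall B, classical_sets.proper A B -> ~ good B.
  apply: classical_sets.Zorn_bigcup => C Cgood Ctot; split.
    have K_case B x a y : C B -> B x -> S B y ->
        S (classical_sets.bigcup C id) (a *: x + y).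
      move=> CB Bx By.
      have [/(_ a x y (or_introl Bx) By)] := Cgood B CB.
      by case=> [?|?]; [left; exists B|right].
    move=> a x y [[B CB Bx]|Kx] [[D CD Dy]|Ky].
    (* Members of a chain are comparable, so both elements lie in the larger one. *)
    - have [BD|DB] := Ctot B D CB CD.
        by apply: (K_case D) => //; [apply: BD|left].
      by apply: (K_case B) => //; left; apply: DB.
    - by apply: (K_case B) => //; right.
    - have [lin _] := Cgood D CD.
      have [?|?] := lin a x y (or_intror Kx) (or_introl Dy); last by right.
      by left; exists D.
    - by right; rewrite rpredD // rpredZ.
  move=> x [[B CB Bx]|//].
  by have [_] := Cgood B CB; apply; left.
have [N NE] := @submodClosed_ofProp R M (S A) (or_intror (rpred0 K)) linA.
exists N; split=> [x Kx|x /NE|W NW WL x Wx]; first by apply/NE; right.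
  exact: AL.
apply/NE; left; apply: boolp.contrapT => nAx.
(* Since [K] \subset [N] \subset [W], adjoining [K] leaves [W] unchanged; so [W] is itself good, and
   [x] makes it strictly larger than [A]. *)
have KW y : S (fun z => z \in W) y -> y \in W.
  by case=> // Ky; apply/NW/NE; right.
apply: (maxA (fun z => z \in W)).
  by split=> [y Ay|WA]; [apply/NW/NE; left|apply/nAx/WA].
split=> [a y z /KW Wy /KW Wz|y /KW]; last exact: WL.
by left; rewrite rpredD // rpredZ.
Qed.

(** Element form of L/K \cong R/P: the class of [e] corresponds to 1. *)
Definition generator_mod {R : comPzRingType} {M : lmodType R}
    (K L : submodClosed M) (P : submodClosed R^o) (e : M) : Prop :=
  [/\ e \in L,
      forall a : R, (a *: e \in K) <-> (a \in P) &
      forall x, x \in L -> exists a : R, x - a *: e \in K].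

Lemma isomorphic_generator_mod (R : comPzRingType) (M : lmodType R)
    (K L : submodClosed M) (P : submodClosed R^o) :
  isomorphic (quotmod (within L K)) (quotmod P) ->
  exists e, generator_mod K L P e.
Proof.
move=> [f bij_f]; have inj_f := bij_inj bij_f; have [g fK gK] := bij_f.
have [e ge] := quotmod_pi_surj (g (quotmod_pi P 1)).
have fe (a : R) : f (quotmod_pi (within L K) (a *: e)) = quotmod_pi P a.
  rewrite linearZ linearZ /= -ge gK -linearZ /=; congr (quotmod_pi P _).
  exact: mulr1.
exists (val e); split=> [|a|x Lx]; first exact: valP.
  have -> : (a *: val e \in K) = (a *: e - 0 \in within L K).
    by rewrite subr0.
  rewrite -[a in a \in P]subr0.
  split=> /quotmod_pi_eq E; apply/quotmod_pi_eq.
    by rewrite -fe E !raddf0.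
  by apply: inj_f; rewrite fe E !raddf0.
pose y : submod L := exist _ x Lx.
have [a fy] := quotmod_pi_surj (f (quotmod_pi (within L K) y)).
exists a.
have: y - a *: e \in within L K by apply/quotmod_pi_eq/inj_f; rewrite fe.
by rewrite unfold_in linearB linearZ.
Qed.

Section MaximalMeeting.
Variables (R : comPzRingType) (M : lmodType R) (K L N : submodClosed M).
Variables (P : submodClosed R^o) (e : M).
Hypothesis primeP : prime_ideal P.
Hypotheses (gen_e : generator_mod K L P e) (maxN : maximal_meeting K L N).

(** As [a *: e] lies in [L], being in [N] is the same as being in [K]: this is the embedding of L/K
    in M/N. *)
Lemma generator_mod_maximal (a : R) : (a *: e \in N) <-> (a \in P).
Proof.
have [Le eP _] := gen_e; have [KN NL _] := maxN.
split=> [Nae|/eP /KN //]; apply/eP/NL => //; exact: rpredZ.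
Qed.

Lemma maximal_meeting_proper : Defs.proper N.
Proof.
exists e; apply/negP => Ne; have [P1 _] := primeP; case/negP: P1.
by apply/generator_mod_maximal; rewrite scale1r.
Qed.

(** Otherwise all multiples of [e] in [W] have coefficient in [P], so [W] \cap [L] \subset [K], and
    maximality gives [W] \subset [N]. *)
Lemma maximal_meeting_essential (W : submodClosed M) :
  {subset N <= W} -> ~ {subset W <= N} ->
  exists2 a : R, a \notin P & a *: e \in W.
Proof.
have [_ eP genL] := gen_e; have [KN _ max] := maxN.
move=> NW nWN; apply: boolp.contrapT => noa; apply: nWN; apply: max => // x Wx Lx.
have [a Kxa] := genL x Lx; rewrite (submod_subrK _ _ _ _ _ Kxa).
apply/eP; apply: boolp.contrapT => /negP nPa; apply: noa; exists a => //.
by rewrite -(submod_subrK _ _ _ x) //; apply/NW/KN.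
Qed.

Lemma maximal_meeting_irreducible : irreducible N.
Proof.
split=> [|W1 W2 NE]; first exact: maximal_meeting_proper.
have sub1 : {subset N <= W1} by move=> x; rewrite NE => /andP[].
have sub2 : {subset N <= W2} by move=> x; rewrite NE => /andP[].
case: (boolp.EM {subset W1 <= N}) => [s1|/(maximal_meeting_essential _ sub1)].
  by left=> x; apply/idP/idP => [/sub1|/s1].
case: (boolp.EM {subset W2 <= N}) => [s2|/(maximal_meeting_essential _ sub2)].
  by right=> x; apply/idP/idP => [/sub2|/s2].
move=> [b nPb W2b] [a nPa W1a].
(* The multiple [(a * b) *: e] lies in both [W1] and [W2], hence in [N]. *)
have: a * b \in P.
  apply/generator_mod_maximal; rewrite NE; apply/andP; split.
    by rewrite mulrC -scalerA rpredZ.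
  by rewrite -scalerA rpredZ.
by have [_ mulP] := primeP; move/mulP; rewrite (negPf nPa) (negPf nPb).
Qed.

Lemma quotmod_scale_eq0 (a : R) (x : M) :
  (a *: quotmod_pi N x = 0) <-> (a *: x \in N).
Proof.
rewrite -linearZ -(raddf0 (quotmod_pi N)) -[X in X \in N]subr0.
exact: quotmod_pi_eq.
Qed.

Lemma prime_ideal_mulr (Q : submodClosed R^o) (a b : R) :
  prime_ideal Q -> b \notin Q -> (a * b \in Q) = (a \in Q).
Proof.
move=> [_ mulQ] nQb; apply/idP/idP => [/mulQ|Qa]; first by rewrite (negPf nQb) orbF.
by rewrite mulrC; apply: (rpredZ b).
Qed.

(** By essentiality N + Rx contains some [a *: e] with [a] outside [P], so [a *: e] agrees with some
    [c *: x] modulo [N]. Comparing annihilators of this common class and cancelling [a] and [c] by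
    primality identifies [Q] with [P]. *)
Lemma maximal_meeting_ann (Q : submodClosed R^o) (x : M) :
  prime_ideal Q -> (forall a : R, a \in Q <-> a *: x \in N) -> Q =i P.
Proof.
move=> primeQ Qx.
have nNx : x \notin N.
  by have [Q1 _] := primeQ; apply: contra Q1 => Nx; apply/Qx; rewrite scale1r.
pose S z := exists c : R, z - c *: x \in N.
have [W WE] : exists W : submodClosed M, forall z, z \in W <-> S z.
  apply: submodClosed_ofProp => [|a y z [c Nc] [d Nd]].
    by exists 0; rewrite scale0r subr0 rpred0.
  exists (a * c + d); rewrite scalerDl -scalerA opprD addrACA -scalerBr.
  by rewrite rpredD // rpredZ.
have NW : {subset N <= W}.
  by move=> z Nz; apply/WE; exists 0; rewrite scale0r subr0.
have nWN : ~ {subset W <= N}.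
  move=> WN; case/negP: nNx; apply/WN/WE.
  by exists 1; rewrite scale1r subrr rpred0.
have [a nPa /WE [c Nac]] := maximal_meeting_essential W NW nWN.
have xe (b : R) : (b * c \in Q) <-> (b * a \in P).
  have E : (b * a *: e \in N) = (b * c *: x \in N).
    by apply: submod_subrK; rewrite -!scalerA -scalerBr rpredZ.
  split=> [/Qx|/generator_mod_maximal]; first by rewrite -E => /generator_mod_maximal.
  by rewrite E => /Qx.
(* This is the case b = 1 of [xe]. *)
have nQc : c \notin Q.
  by apply: contra nPa => Qc; rewrite -[a]mul1r; apply/xe; rewrite mul1r.
move=> b; rewrite -(prime_ideal_mulr Q b c) // -(prime_ideal_mulr P b a) //.
by apply/idP/idP => /xe.
Qed.

Lemma maximal_meeting_primary : primary P N.
Proof.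
split=> [|Q]; first exact: maximal_meeting_proper.
split=> [[primeQ [q qQ]]|QP].
  have [x qE] := quotmod_pi_surj q.
  apply: (maximal_meeting_ann Q x) => // a; rewrite qE in qQ.
  by split=> [/qQ/quotmod_scale_eq0|/quotmod_scale_eq0/qQ].
split.
  by have [P1 mulP] := primeP; split=> [|u v]; rewrite !QP //; apply: mulP.
(* The class of [e] in M/N has annihilator [P]. *)
exists (quotmod_pi N e) => a; rewrite QP.
split=> [/generator_mod_maximal/quotmod_scale_eq0//|].
by move/quotmod_scale_eq0/generator_mod_maximal.
Qed.

End MaximalMeeting.

(** Indices in ['I_r] start at 0, so [N j] stands for N_{j+1} and the intersection runs over i < j+1
    \le r; it is empty, hence [M], for i = r. *)
Lemma filtration_bigcap (R : pzRingType) (M : lmodType R) (r : nat)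
    (F : 'I_r.+1 -> submodClosed M) (N : 'I_r -> submodClosed M) :
  F ord_max =i predT ->
  (forall j : 'I_r, {subset F (widen_ord (leqnSn r) j) <= F (lift ord0 j)}) ->
  (forall j : 'I_r, {subset F (widen_ord (leqnSn r) j) <= N j}) ->
  (forall (j : 'I_r) x, x \in N j -> x \in F (lift ord0 j) ->
     x \in F (widen_ord (leqnSn r) j)) ->
  forall i : 'I_r.+1,
    F i =i [pred x | [forall j : 'I_r, (i < j.+1)%N ==> (x \in N j)]].
Proof.
move=> FT FS FN NF i x; rewrite inE.
have widenE (j : 'I_r) : widen_ord (leqnSn r) j = inord j.
  by apply: val_inj; rewrite /= inordK // ltnS ltnW.
have liftE (j : 'I_r) : lift ord0 j = inord j.+1.
  by apply: val_inj; rewrite /= inordK // ltnS.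
apply/idP/forallP => [Fx j|Nx].
  apply/implyP; rewrite ltnS => le_ij; apply: FN; rewrite widenE.
  have: (j <= r)%N by apply: ltnW.
  (* Climbing the filtration: F_i \subset F_k whenever i \le k \le r. *)
  elim: (j : nat) le_ij => [|k IH].
    by rewrite leqn0 => /eqP i0 _; rewrite -i0 inord_val.
  rewrite leq_eqVlt => /predU1P[<- _|]; first by rewrite inord_val.
  rewrite ltnS => le_ik lt_kr; have := FS (Ordinal lt_kr) x.
  by rewrite widenE liftE; apply; apply: IH => //; apply: ltnW.
(* Descent from F_r = M, [d] counting the steps taken; d = r - i reaches F_i. *)
suff Fk d : (d <= r - i)%N -> x \in F (inord (r - d)).
  by move: (Fk (r - i)%N (leqnn _)); rewrite subKn ?inord_val // -ltnS.
elim: d => [_|d IH lt_d].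
  by rewrite subn0 (_ : inord r = ord_max) ?FT //; apply: val_inj; rewrite /= inordK.
have lt_dr : (d < r)%N by apply: leq_trans lt_d (leq_subr _ _).
have lt_kr : (r - d.+1 < r)%N by rewrite ltn_subrL; apply: leq_ltn_trans lt_dr.
(* The filtration step with 0-based index r-d-1 leads from F_{r-d} down to F_{r-d-1}; its [N] occurs
   in the intersection because i \le r-d-1. *)
have := NF (Ordinal lt_kr) x; rewrite widenE liftE /= -subSn // subSS; apply.
  have /implyP := Nx (Ordinal lt_kr); apply; rewrite /= ltnS.
  by rewrite leq_subRL // addnC -leq_subRL // -ltnS.
by apply: IH; apply: ltnW.
Qed.

Theorem proposition7p1 (R : comPzRingType) (M : lmodType R) (r : nat)
    (F : 'I_r.+1 -> submodClosed M) (P : 'I_r -> submodClosed R^o)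
    (noethR : noetherian R) (fgM : finitely_generated M)
    (filtF : prime_filtration F P) :
  exists N : 'I_r -> submodClosed M,
    (forall j : 'I_r, irreducible (N j) /\ primary (P j) (N j)) /\
    (forall i : 'I_r.+1,
       F i =i [pred x | [forall j : 'I_r, (i < j.+1)%N ==> (x \in N j)]]).
Proof.
have [_ FT step] := filtF.
have [N maxN] := boolp.choice (fun j : 'I_r => exists_maximal_meeting R M
  (F (widen_ord (leqnSn r) j)) (F (lift ord0 j))).
exists N; split=> [j|].
  have [_ primeP /isomorphic_generator_mod [e gen_e]] := step j.
  split; first exact: maximal_meeting_irreducible primeP gen_e (maxN j).
  exact: maximal_meeting_primary primeP gen_e (maxN j).
apply: filtration_bigcap => // j; first by have [] := step j.
  by have [] := maxN j.
by have [] := maxN j.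
Qed.
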